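(* Let $(\mathcal{A},\mathbf{m})$ be a multi-arrangement. If $X\in L(\mathcal{A})$ is a flat such that $\mathcal{A}_X$ is generic and $|\mathcal{A}_X|>r(X)$, then $\mathrm{pdim}_S(D(\mathcal{A},\mathbf{m}))\ge r(X)-2$. In particular, if the matroid of $\mathcal{A}$ has a closed circuit of length $m$, then $\mathrm{pdim}_S(D(\mathcal{A},\mathbf{m}))\ge m-3$.
   Context: Let $\mathbb{K}$ be a field, $V$ a finite-dimensional $\mathbb{K}$-vector space, $S=\mathrm{Sym}(V^* )$. An arrangement $\mathcal{A}$ in $V$ is a finite set of linear hyperplanes $H=\ker\alpha_H$ ($0\ne\alpha_H\in V^*$). Its intersection lattice $L(\mathcal{A})$ is the set of intersections of hyperplanes of $\mathcal{A}$ ordered by reverse inclusion; $r(X)$ is the codimension of $X$, and $\mathcal{A}_X=\{H\in\mathcal{A}:X\subseteq H\}$. A multi-arrangement $(\mathcal{A},\mathbf{m})$ is an arrangement with $\mathbf{m}:\mathcal{A}\to\mathbb{Z}_{>0}$, and $D(\mathcal{A},\mathbf{m})=\{\theta\in\mathrm{Der}_{\mathbb{K}}(S):\theta(\alpha_H)\in\langle\alpha_H^{\mathbf{m}(H)}\rangle\ \forall H\in\mathcal{A}\}$. An arrangement of rank $r$ (codimension of the intersection of all its hyperplanes) is generic if the intersection of every subset of $k\le r$ of its hyperplanes has codimension $k$. The matroid of $\mathcal{A}$ is the linear matroid on $\mathcal{A}$ given by the vectors $\alpha_H$; a closed circuit is a circuit which is also a flat of this matroid. $\mathrm{pdim}$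 is projective dimension. *)

(* Defs.v *)
From HB Require Import structures.
From mathcomp Require Import all_boot all_order all_algebra finmap.
From mathcomp Require Import boolp functions.
From mathcomp Require Import mpoly.

Set Implicit Arguments.
Unset Strict Implicit.
Unset Printing Implicit Defensive.

Import GRing.Theory.
Local Open Scope fset_scope.
Local Open Scope ring_scope.

Section ProjectiveDimension.
Variable R : nzRingType.

Definition projective (P : lmodType R) : Prop :=
  forall (M N : lmodType R) (g : {linear M -> N}) (f : {linear P -> N}),
    (forall y, exists x, g x = y) ->
    exists h : {linear P -> M}, forall p, g (h p) = f p.

(* ... -> res_obj 1 -> res_obj 0 -> M -> 0 *)
Record proj_resolution (M : lmodType R) := ProjResolution {
  res_obj : nat -> lmodType R;
  res_diff : forall i, {linear res_obj i.+1 -> res_obj i};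
  res_aug : {linear res_obj 0%N -> M};
  res_projective : forall i, projective (res_obj i);
  res_aug_surj : forall y, exists x, res_aug x = y;
  res_exact0 : forall x, res_aug x = 0 <-> exists y, res_diff 0 y = x;
  res_exactS : forall i x,
    res_diff i x = 0 <-> exists y, res_diff i.+1 y = x
}.

Definition has_resolution_of_length (M : lmodType R) (n : nat) : Prop :=
  exists P : proj_resolution M,
    forall i, (n < i)%N -> forall x : res_obj P i, x = 0.

Lemma pdim_subproof (M : lmodType R) :
  (exists n, has_resolution_of_length M n) ->
  exists n, `[< has_resolution_of_length M n >].
Proof. by case=> n Pn; exists n; apply/asboolP. Qed.

(* None stands for infinite projective dimension; the zero module gets 0. *)
Definition pdim (M : lmodType R) : option nat :=
  if pselect (exists n, has_resolution_of_length M n) is left exP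
  then Some (ex_minn (pdim_subproof exP)) else None.

Definition pdim_ge (M : lmodType R) (k : nat) : Prop :=
  if pdim M is Some d then (k <= d)%N else True.

End ProjectiveDimension.

Section Arrangements.
Variables (K : fieldType) (V : vectType K).

Implicit Types (A B C F : {fset {vspace V}}) (X H : {vspace V}).
Implicit Types (alpha : {vspace V} -> 'Hom(V, K^o)) (m : {vspace V} -> nat).

(* alpha H is the chosen defining form of H; its values outside A are
   irrelevant. *)
Definition arrangement A alpha : Prop :=
  forall H, H \in A -> alpha H != 0 /\ lker (alpha H) = H.

Definition multi_arrangement A alpha m : Prop :=
  arrangement A alpha /\ forall H, H \in A -> (0 < m H)%N.

Definition codim X : nat := (\dim {:V} - \dim X)%N.

Definition intersection B : {vspace V} := (\bigcap_(H <- enum_fset B) H)%VS.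

(* The empty intersection, V itself, belongs to the lattice. *)
Definition in_lattice A X : Prop := exists2 B, B `<=` A & X = intersection B.

Definition localization A X : {fset {vspace V}} :=
  [fset H in A | (X <= H)%VS].

Definition generic A : Prop :=
  forall B, B `<=` A -> (#|` B| <= codim (intersection A))%N ->
    codim (intersection B) = #|` B|.

Definition matroid_rank alpha B : nat :=
  \dim <<[seq alpha H | H <- enum_fset B]>>%VS.

Definition matroid_indep alpha B : Prop := matroid_rank alpha B = #|` B|.

Definition matroid_circuit A alpha C : Prop :=
  [/\ C `<=` A, ~ matroid_indep alpha C
    & forall B, B `<` C -> matroid_indep alpha B].

Definition matroid_flat A alpha F : Prop :=
  F `<=` A /\ forall H, H \in A -> H \notin F ->
    (matroid_rank alpha F < matroid_rank alpha (H |` F))%N.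

Definition closed_circuit A alpha C : Prop :=
  matroid_circuit A alpha C /\ matroid_flat A alpha C.

(* Sym(V^* ) as the polynomial ring on the basis of V^* dual to
   vbasis {:V}. *)
Local Notation S := {mpoly K[\dim {:V}]}.

Definition form_poly (a : 'Hom(V, K^o)) : S :=
  \sum_(i < \dim {:V}) (a (vbasis {:V})`_i : K) *: 'X_i.

Definition derivation (theta : S -> S) : Prop :=
  [/\ forall (c : K) p q, theta (c *: p + q) = c *: theta p + theta q
    & forall p q, theta (p * q) = theta p * q + p * theta q].

Definition log_derivation A alpha m (theta : S -> S) : Prop :=
  derivation theta /\
  forall H, H \in A ->
    exists q, theta (form_poly (alpha H)) = q * form_poly (alpha H) ^+ m H.

Definition log_pred A alpha m : {pred (S -> S^o)} :=
  fun theta => `[< log_derivation A alpha m theta >].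

Lemma log_pred_submod A alpha m : submod_closed (log_pred A alpha m).
Proof.
split=> [|p f g /asboolP[[fl fD] fA] /asboolP[[gl gD] gA]]; apply/asboolP.
  split; first split=> [c p q | p q].
  - by rewrite -[LHS]/(0 : S) -[RHS]/(c *: (0 : S) + 0) scaler0 addr0.
  - by rewrite -[LHS]/(0 : S) -[RHS]/((0 : S) * q + p * 0) mul0r mulr0 addr0.
  by move=> H _; exists 0; rewrite mul0r.
split; first split=> [c a b | a b].
- rewrite -[LHS]/(p * f (c *: a + b) + g (c *: a + b)).
  rewrite -[RHS]/(c *: (p * f a + g a) + (p * f b + g b)).
  by rewrite fl gl mulrDr -scalerAr scalerDr addrACA.
- rewrite -[LHS]/(p * f (a * b) + g (a * b)).
  rewrite -[RHS]/((p * f a + g a) * b + a * (p * f b + g b)).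
  by rewrite fD gD mulrDr mulrDl mulrDr addrACA !mulrA [p * a]mulrC.
move=> H HA; have [q1 e1] := fA H HA; have [q2 e2] := gA H HA.
exists (p * q1 + q2); set l := form_poly _ in e1 e2 *.
rewrite -[LHS]/(p * f l + g l) e1 e2 mulrDl mulrA //.
Qed.

HB.instance Definition _ A alpha m :=
  GRing.isSubmodClosed.Build S (S -> S^o) (log_pred A alpha m)
    (log_pred_submod A alpha m).

Record log_module A alpha m := LogDer {
  log_fun : S -> S^o;
  _ : log_fun \in log_pred A alpha m
}.

HB.instance Definition _ A alpha m :=
  [isSub for @log_fun A alpha m].
HB.instance Definition _ A alpha m := [Choice of log_module A alpha m by <:].
HB.instance Definition _ A alpha m :=
  [SubChoice_isSubLmodule of log_module A alpha m by <:].

End Arrangements.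

(* Main.v *)
Require Import Defs.
From HB Require Import structures.
From mathcomp Require Import all_boot all_order all_algebra finmap.
From mathcomp Require Import boolp functions.
From mathcomp Require Import mpoly.
From mathcomp Require monalg.
From mathcomp Require Import ring.

(** Write S for the polynomial ring, D for the module of logarithmic
derivations, r for the codimension of X, and ell H for the linear form of H.
Nothing is to be shown unless r >= 3.

Projective dimension is bounded below by Koszul cohomology.  If r elements of
a commutative ring form a regular sequence and a module M has a projective
resolution of length d, then the Koszul cohomology of M vanishes in all degrees
j with j + d < r (koszul_resolution): it does so for S, hence for projectives,
and one loses one degree with each step of the resolution.  Here the regular
sequence consists of r independent forms ell H with H containing X.  So it is
enough to exhibit a nonzero class of degree 2 with coefficients in D.

The class comes from the cokernel Q of the map sending a derivation theta to the
family of residues of theta(ell H) modulo ell H ^ m H.  An element of Q is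
killed by the ideal P of X exactly when its multiples by the r forms lift to
derivations theta_H; the elements ell H * theta_H' - ell H' * theta_H then lie
in D and form a 2-cocycle of D.  If it were the coboundary of a family eta_H in
D, the differences theta_H - eta_H would be the multiples by ell H of a single
derivation, because a form is a nonzerodivisor modulo the powers of a form not
proportional to it, and this derivation would lift the given element of Q
(attained_gluing, koszul2_boundary).

It remains to find a nonzero element of Q killed by P.  Such an element is
looked for among the multiples of a basis vector e_k with k containing X.
 - Let f be the product of the ell H ^ m H over the hyperplanes H that do not
   contain X; multiplying by f makes these hyperplanes harmless.  The element
   f e_k is nonzero: there are more than r hyperplanes through X and they are
   generic, so ell k is a combination of r others, and a derivation that sends
   these others into P sends ell k into P, while f is not in P
   (not_attained_outer).
 - Multiply f e_k by powers of the forms ell H, H containing X, keeping it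
   nonzero, until each ell H either kills it or has been used m H times
   (socle_element).  If fewer than r forms killed the outcome, they would be
   independent, so a constant vector field would take the value 1 on ell k and
   0 on the others, and the multiple of this field by the accumulated
   coefficient would lift the element.  Hence at least r forms kill it
   (socle_hyperplanes), and r of them generate P.

A closed circuit C reduces to the first part with X the intersection of its
hyperplanes: being a flat, C is the localization at X; being a circuit, it is
generic of rank one less than its size. *)

Set Implicit Arguments.
Unset Strict Implicit.
Unset Printing Implicit Defensive.

Import GRing.Theory.

(** * Koszul cochains and regular sequences *)

Section KoszulCochains.
Local Open Scope ring_scope.
Variable R : comNzRingType.
Implicit Types (M N L : lmodType R) (t ys : seq R) (i : nat).

(** All cochains at once, of every degree: adjoining an element y to the
sequence writes a cochain as a + b e with e the new exterior generator, and
stores it as the pair (a, b). *)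
Fixpoint koszul M ys : lmodType R :=
  if ys is _ :: t then (koszul M t * koszul M t)%type : lmodType R else M.

Fixpoint kd M ys : koszul M ys -> koszul M ys :=
  match ys return koszul M ys -> koszul M ys with
  | [::] => fun=> 0
  | y :: t => fun c => (kd c.1, y *: c.1 - kd c.2)
  end.

(** Homogeneity of degree i - 1.  The shift makes 0 stand for degree -1,
where every cochain vanishes, so that the recursion on the second component
needs no separate case. *)
Fixpoint kdeg M ys i : koszul M ys -> Prop :=
  match ys return koszul M ys -> Prop with
  | [::] => fun c => i = 1%N \/ c = 0
  | _ :: _ => fun c => kdeg i c.1 /\ kdeg i.-1 c.2
  end.

Fixpoint kmap M N (f : M -> N) ys : koszul M ys -> koszul N ys :=
  match ys return koszul M ys -> koszul N ys with
  | [::] => f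
  | _ :: _ => fun c => (kmap f c.1, kmap f c.2)
  end.

Lemma kd_linear M ys : linear (@kd M ys).
Proof.
elim: ys => [|y t IH] a u v /=; first by rewrite scaler0 addr0.
apply: injective_projections => /=; rewrite IH //.
rewrite scalerDr scalerBr !scalerA [a * y]mulrC opprD.
by rewrite addrACA.
Qed.
HB.instance Definition _ M ys :=
  GRing.isLinear.Build R (koszul M ys) (koszul M ys) _ (@kd M ys)
    (@kd_linear M ys).

Lemma kdK M ys (c : koszul M ys) : kd (kd c) = 0.
Proof.
elim: ys c => [|y t IH] c //=.
by rewrite linearB linearZ /= !IH subr0 subrr.
Qed.

Lemma kdeg_linear M ys i a (u v : koszul M ys) :
  kdeg i u -> kdeg i v -> kdeg i (a *: u + v).
Proof.
elim: ys i u v => [|y t IH] i u v /=.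
  move=> [->|->]; first by left.
  by move=> [->|->]; [left|right; rewrite scaler0 addr0].
by move=> [u1 u2] [v1 v2]; split; apply: IH.
Qed.

Lemma kdeg_zero M ys i : kdeg i (0 : koszul M ys).
Proof. by elim: ys i => [|y t IH] i /=; [right | split; apply: IH]. Qed.

Lemma kdegB M ys i (u v : koszul M ys) :
  kdeg i u -> kdeg i v -> kdeg i (u - v).
Proof.
by move=> du dv; rewrite -scaleN1r addrC; apply: kdeg_linear.
Qed.

Lemma kdegZ M ys i a (u : koszul M ys) : kdeg i u -> kdeg i (a *: u).
Proof.
move=> du; rewrite -[_ *: _]addr0.
by apply: kdeg_linear => //; apply: kdeg_zero.
Qed.

Lemma kdeg0 M ys (c : koszul M ys) : kdeg 0 c -> c = 0.
Proof.
elim: ys c => [|y t IH] c /=; first by case.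
by move=> [/IH c1 /IH c2]; apply: injective_projections.
Qed.

Lemma kdeg_gt M ys i (c : koszul M ys) :
  (size ys < i.-1)%N -> kdeg i c -> c = 0.
Proof.
elim: ys i c => [|y t IH] [|[|i]] c //= ilt; first by case.
move=> [/IH c1 /IH c2]; apply: injective_projections; first exact/c1/ltnW.
exact: c2.
Qed.

Lemma kdeg_kd M ys i (c : koszul M ys) : kdeg i c -> kdeg i.+1 (kd c).
Proof.
elim: ys i c => [|y t IH] i c /=; first by right.
move=> [c1 c2]; split; first exact: IH.
apply: kdegB; first exact: kdegZ.
case: i c1 c2 => [|i] _; last exact: IH.
by move=> /kdeg0 ->; rewrite linear0; apply: kdeg_zero.
Qed.

Lemma kmap_linear M N (f : {linear M -> N}) ys : linear (@kmap M N f ys).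
Proof.
elim: ys => [|y t IH] a u v /=; first exact: linearP.
by apply: injective_projections => /=; rewrite IH.
Qed.
HB.instance Definition _ M N (f : {linear M -> N}) ys :=
  GRing.isLinear.Build R (koszul M ys) (koszul N ys) _ (@kmap M N f ys)
    (@kmap_linear M N f ys).

Lemma kmap_kd M N (f : {linear M -> N}) ys (c : koszul M ys) :
  kmap f (kd c) = kd (kmap f c).
Proof.
elim: ys c => [|y t IH] c /=; first exact: linear0.
by rewrite linearB linearZ /= !IH.
Qed.

Lemma kdeg_map M N (f : {linear M -> N}) ys i (c : koszul M ys) :
  kdeg i c -> kdeg i (kmap f c).
Proof.
elim: ys i c => [|y t IH] i c /=.
  by move=> [->|->]; [left|right; rewrite linear0].
by move=> [c1 c2]; split; apply: IH.
Qed.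

Lemma kmap_comp M N L (g : N -> L) (f : M -> N) ys (c : koszul M ys) :
  kmap g (kmap f c) = kmap (g \o f) c.
Proof. by elim: ys c => [|y t IH] c //=; rewrite !IH. Qed.

Lemma eq_kmap M N (f g : M -> N) ys :
  f =1 g -> @kmap M N f ys =1 @kmap M N g ys.
Proof. by move=> fg; elim: ys => [|y t IH] c //=; rewrite !IH. Qed.

Lemma kmap_inj M N (f : M -> N) ys : injective f -> injective (@kmap M N f ys).
Proof.
move=> fI; elim: ys => [|y t IH] //= [a b] [a' b'] /= [].
by move=> /IH -> /IH ->.
Qed.

(** Cochains are finite families of elements, so an exact sequence of modules
stays exact on cochains, degree by degree. *)
Lemma kmap_exact M N L (f : {linear M -> N}) (g : {linear N -> L}) ys i
    (c : koszul N ys) :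
  (forall x, g x = 0 -> exists y, f y = x) ->
  kdeg i c -> kmap g c = 0 -> exists2 b : koszul M ys, kdeg i b & kmap f b = c.
Proof.
move=> fg; elim: ys i c => [|y t IH] i c /=.
  move=> [->|->] gc; last by exists 0; [right | rewrite linear0].
  by have [b fb] := fg c gc; exists b; [left|].
move=> [c1 c2] [/(IH _ _ c1)[b1 d1 f1] /(IH _ _ c2)[b2 d2 f2]].
exists (b1, b2) => //=.
by apply: injective_projections.
Qed.

Section Regular.
Fixpoint ideal_of ys (g : R) : Prop :=
  if ys is y :: t then exists h, ideal_of t (g - y * h) else g = 0.

(** Weak regularity: the quotient by the sequence may be zero.  The last
element of the list comes first in the regular sequence, to match the recursion
of the cochains. *)
Fixpoint regular ys : Prop :=
  if ys is y :: t then
    regular t /\ forall g, ideal_of t (y * g) -> ideal_of t g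
  else True.

(** The module of top-degree cochains over R is a copy of R; the next lemmas
identify the coboundaries in it with the ideal of the sequence. *)
Fixpoint ktop ys (g : R) : koszul R^o ys :=
  match ys return koszul R^o ys with
  | [::] => g
  | _ :: t => (0, ktop t g)
  end.

Lemma ktopZ ys (y g : R) : ktop ys (y * g) = y *: ktop ys g.
Proof.
elim: ys => [|z t IH] //=; rewrite IH.
by apply: injective_projections; rewrite /= ?scaler0.
Qed.

Lemma ktopB ys (g h : R) : ktop ys (g - h) = ktop ys g - ktop ys h.
Proof.
elim: ys => [|z t IH] //=; rewrite IH.
by apply: injective_projections; rewrite /= ?subr0.
Qed.

Lemma kdeg_top ys (c : koszul R^o ys) :
  kdeg (size ys).+1 c -> exists g, c = ktop ys g.
Proof.
elim: ys c => [|y t IH] c /=; first by exists c.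
move=> [/kdeg_gt c1 /IH[g c2]]; exists g.
by apply: injective_projections => //=; apply: c1.
Qed.

Lemma top_kdeg ys g : kdeg (size ys).+1 (ktop ys g).
Proof.
elim: ys => [|y t IH] /=; first by left.
by split=> //; apply: kdeg_zero.
Qed.

Lemma kd_top ys g : kd (ktop ys g) = 0.
Proof.
apply: (@kdeg_gt _ _ (size ys).+2) => //.
exact/kdeg_kd/top_kdeg.
Qed.

Lemma ktop_coboundary ys g :
  ideal_of ys g -> exists2 b, kdeg (size ys) b & kd b = ktop ys g.
Proof.
elim: ys g => [|y t IH] g /=.
  by move=> ->; exists 0; [right |].
move=> [h /IH [b bdeg db]].
exists (ktop t h, - b); first split=> /=; first exact: top_kdeg.
  by rewrite -sub0r; apply: kdegB => //; apply: kdeg_zero.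
rewrite /= kd_top linearN /= db opprK.
by rewrite ktopB ktopZ addrC subrK.
Qed.

Lemma coboundary_top ys g b :
  kdeg (size ys) b -> kd b = ktop ys g -> ideal_of ys g.
Proof.
elim: ys g b => [|y t IH] g b /=; first by [].
move=> [/kdeg_top [h b1] b2] [_]; rewrite b1 => e; exists h.
apply: (IH _ (- b.2)).
  by rewrite -sub0r; apply: kdegB => //; apply: kdeg_zero.
by rewrite linearN ktopB ktopZ /= -e addrAC subrr add0r.
Qed.

(** With y in front of t, a cocycle (a, b) has a closed and y a = d b.  Below
the top degree of t the cochain a is exact by induction; in that degree y a
being exact says that y kills the class of a in R modulo t, so that regularity
makes a exact.  Once a = d a', the difference b - y a' is a cocycle of lower
degree, exact by induction again. *)
Theorem koszul_regular ys i (c : koszul R^o ys) :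
  regular ys -> (i <= size ys)%N -> kdeg i c -> kd c = 0 ->
  exists2 b, kdeg i.-1 b & kd b = c.
Proof.
elim: ys i c => [|y t IH] i c /=.
  by rewrite leqn0 => _ /eqP -> [|->] // _; exists 0; [right|].
move=> [treg yreg] ilt [c1 c2] [dc1 e].
have {}e : y *: c.1 = kd c.2 by apply/eqP; rewrite -subr_eq0 e.
have [a adeg ea] : exists2 a, kdeg i.-1 a & kd a = c.1.
  move: ilt; rewrite leq_eqVlt => /orP[/eqP ei|ilt]; last exact: IH.
  move: c1 c2; rewrite ei => /kdeg_top [g c1] c2.
  rewrite c1; apply: ktop_coboundary; apply: yreg.
  apply: (coboundary_top c2); rewrite -e c1.
  by rewrite ktopZ.
have [//||||b bdeg eb] := IH i.-1 (c.2 - y *: a).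
- by case: (i) ilt => //= i' /ltnW.
- by apply: kdegB => //; apply: kdegZ.
- by rewrite linearB linearZ /= ea e subrr.
exists (a, - b); first split=> //=.
  by rewrite -sub0r; apply: kdegB => //; apply: kdeg_zero.
apply: injective_projections => //=.
by rewrite linearN /= opprK eb addrC subrK.
Qed.
End Regular.

End KoszulCochains.

(** * Koszul cohomology of modules with a short projective resolution *)

Section Projective.
Local Open Scope fset_scope.
Local Open Scope ring_scope.
Variable R : comNzRingType.

Section FreeCover.
Import monalg.
Variable P : lmodType R.
Notation free := ({malg R[P]}).

Definition free_eval (g : free) : P :=
  \sum_(x <- msupp g) mcoeff x g *: x.

Lemma free_evalE (g : free) (d : {fset P}) : msupp g `<=` d ->
  free_eval g = \sum_(x <- d) mcoeff x g *: x.
Proof.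
move=> gd; apply: big_fset_incl => // x _ /mcoeff_outdom ->.
exact: scale0r.
Qed.

Lemma free_eval_linear : linear free_eval.
Proof.
move=> a u v; pose d := msupp u `|` msupp v
  `|` msupp (a *: u + v).
(* A common support for the three evaluations. *)
have [ud vd wd] : [/\ msupp u `<=` d, msupp v `<=` d
    & msupp (a *: u + v) `<=` d].
  rewrite /d fsubsetUr -fsetUA fsubsetUl; split=> //.
  by rewrite fsetUCA fsubsetUl.
rewrite (free_evalE ud) (free_evalE vd) (free_evalE wd) scaler_sumr -big_split.
by apply: eq_bigr => x _; rewrite /= mcoeffD mcoeffZ scalerDl scalerA.
Qed.
HB.instance Definition _ := GRing.isLinear.Build R free P _ free_eval
  free_eval_linear.

Lemma free_eval_surj (x : P) : exists g, free_eval g = x.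
Proof.
exists (mkmalgU x 1); rewrite (@free_evalE _ [fset x]).
  by rewrite big_seq_fset1 mcoeffUU scale1r.
apply/fsubsetP => z; rewrite -mcoeff_neq0 mcoeffU inE.
by case: (eqVneq x z) => // _; rewrite mulr0n eqxx.
Qed.

(** The dual basis lemma: a projective module is a retract of the free module
on its underlying set, and the coordinates of a section are linear forms. *)
Lemma projective_coordinates : projective P ->
  exists h : P -> {linear P -> R^o}, forall p, exists s : {fset P},
    forall d, s `<=` d -> \sum_(x <- d) h x p *: x = p.
Proof.
move=> /(_ free P free_eval idfun free_eval_surj) [h hK].
pose c (x p : P) : R^o := mcoeff x (h p).
have cl x : linear (c x).
  move=> a u v; rewrite /c linearD linearZ /=.
  by rewrite mcoeffD mcoeffZ.
exists (fun x => HB.pack_for {linear P -> R^o} (c x)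
  (GRing.isLinear.Build R P R^o _ (c x) (cl x))).
move=> p; exists (msupp (h p)) => d hd /=.
by rewrite -[RHS](hK p) /= (free_evalE hd).
Qed.
End FreeCover.

(** The dual basis expansion of each of the finitely many components of a
cochain, over a common support. *)
Lemma koszul_coordinates (P : lmodType R) (h : P -> {linear P -> R^o}) :
  (forall p, exists s : {fset P},
    forall d, s `<=` d -> \sum_(x <- d) h x p *: x = p) ->
  forall (ys : seq R) (c : koszul P ys), exists s : {fset P},
    forall d, s `<=` d ->
      \sum_(x <- d) kmap (fun a : R^o => a *: x) (kmap (h x) c) = c.
Proof.
move=> hP; elim=> [|y t IH] c; first exact: hP.
have [s1 e1] := IH c.1; have [s2 e2] := IH c.2.
exists (s1 `|` s2) => d; rewrite fsubUset => /andP[d1 d2].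
apply: injective_projections.
  by rewrite raddf_sum /= e1.
by rewrite raddf_sum /= e2.
Qed.

(** The dual basis writes a cocycle as a finite sum of images of cocycles over
the ring under the maps a |-> a x, and each of these is a coboundary. *)
Theorem koszul_projective (P : lmodType R) ys i (c : koszul P ys) :
  projective P -> regular ys -> (i <= size ys)%N -> kdeg i c -> kd c = 0 ->
  exists2 b, kdeg i.-1 b & kd b = c.
Proof.
move=> /projective_coordinates[h hP] yreg ilt ci dc.
have [s /(_ s (fsubset_refl _)) e] := koszul_coordinates hP c.
have scl (x : P) : linear (fun a : R^o => a *: x : P).
  by move=> a u v; rewrite scalerDl -scalerA.
pose sc (x : P) := HB.pack_for {linear R^o -> P} (fun a : R^o => a *: x)
  (GRing.isLinear.Build R R^o P _ _ (scl x)).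
rewrite -e; elim: (enum_fset s) => [|x r [b bi db]].
  by exists 0; [apply: kdeg_zero | rewrite big_nil linear0].
have [//|b' b'i db'] := koszul_regular yreg ilt (kdeg_map (h x) ci).
  by rewrite -kmap_kd dc linear0.
exists (kmap (sc x) b' + b).
  by rewrite -[kmap _ _]scale1r; apply: kdeg_linear => //; apply: kdeg_map.
rewrite big_cons -db linearD; congr (_ + _).
by rewrite -db'; symmetry; apply: (kmap_kd (sc x)).
Qed.

(** Vanishing of the Koszul cohomology of the image of f, phrased with cochains
of the source of f so that the image need not be made into a module. *)
Definition image_acyclic (M N : lmodType R) (f : {linear M -> N}) ys i :=
  forall c : koszul M ys, kdeg i c -> kd (kmap f c) = 0 ->
  exists2 b : koszul M ys, kdeg i.-1 b & kd (kmap f b) = kmap f c.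

(** Dimension shift along L -> P -> N exact at P.  If the image of c in N is
closed then d c comes from the image of L, where it is exact one degree higher;
correcting c by a primitive gives a cocycle of P, exact since P is
projective. *)
Lemma image_acyclic_step (L P N : lmodType R) (g : {linear L -> P})
    (f : {linear P -> N}) ys i :
  projective P -> regular ys -> (i <= size ys)%N ->
  (forall x, f x = 0 <-> exists y, g y = x) ->
  image_acyclic g ys i.+1 -> image_acyclic f ys i.
Proof.
move=> Pproj yreg ilt fg gac c ci dfc.
have [e' e'i ge'] : exists2 e', kdeg i.+1 e' & kmap g e' = kd c.
  apply: (kmap_exact (f := g) (g := f)); last by rewrite kmap_kd.
    by move=> x /fg.
  exact: kdeg_kd.
have [|b' b'i db'] := gac e' e'i; first by rewrite ge' kdK.
have [||b bi db] := koszul_projective Pproj yreg ilt (c := c - kmap g b').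
- by apply: kdegB => //; apply: kdeg_map.
- by rewrite linearB /= db' ge' subrr.
exists b => //; rewrite -kmap_kd db linearB /= kmap_comp.
rewrite (eq_kmap (f := f \o g) (g := \0)) => [|x]; last by apply/fg; exists x.
have -> : kmap (\0 : L -> N) b' = 0.
  by elim: (ys) b' {b'i db' db} => [|y t IH] //= b'; rewrite !IH.
by rewrite subr0.
Qed.

(** Each of the modules of the resolution costs one degree: the projective in
position j is used in degree j above that of c. *)
Theorem koszul_resolution (M : lmodType R) n ys i (c : koszul M ys) :
  has_resolution_of_length M n -> regular ys -> (i + n <= size ys)%N ->
  kdeg i c -> kd c = 0 -> exists2 b, kdeg i.-1 b & kd b = c.
Proof.
move=> [F Fn] yreg ilt ci dc.
have diff_acyclic k j i' : (n <= j + k)%N -> (i' + k <= (size ys).+1)%N ->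
    image_acyclic (res_diff F j) ys i'.
  elim: k j i' => [|k IH] j i' nj i'k.
    move=> c' _ _; exists 0; first exact: kdeg_zero.
    suff -> : c' = 0 by rewrite !linear0.
    rewrite addn0 in nj.
    elim: (ys) c' => [|y t IHt] /=; first exact: Fn.
    by case=> a b; rewrite (IHt a) (IHt b).
  apply: image_acyclic_step => //; first exact: res_projective.
  - by rewrite -ltnS; apply: leq_trans i'k; rewrite addnS ltnS leq_addr.
  - exact: res_exactS.
  - by apply: IH; rewrite ?addSnnS.
have aug_acyclic : image_acyclic (res_aug F) ys i.
  apply: image_acyclic_step => //; first exact: res_projective.
  - by apply: leq_trans ilt; apply: leq_addr.
  - exact: res_exact0.
  - exact: (diff_acyclic n).
(* Surjectivity of the augmentation is exactness in front of the zero map. *)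
have [||c0 c0i e0] :=
    @kmap_exact _ _ _ _ (res_aug F) (\0 : {linear M -> M}) _ i c _ ci.
- by move=> x _; apply: res_aug_surj.
- by elim: (ys) (c) => [|y t IH] //= c'; rewrite !IH.
have [|b bi db] := aug_acyclic c0 c0i; first by rewrite e0.
by exists (kmap (res_aug F) b); [apply: kdeg_map | rewrite db].
Qed.

End Projective.

(** * Cochains of degree at most two *)

Section LowDegree.
Local Open Scope ring_scope.
Variables (R : comNzRingType) (I : eqType) (y : I -> R).
Implicit Types (D M N : lmodType R) (hs : seq I).

Fixpoint kcst M ys (z : M) : koszul M ys :=
  match ys return koszul M ys with
  | [::] => z
  | _ :: t => (kcst t z, 0)
  end.

Fixpoint kone M hs (u : I -> M) : koszul M (map y hs) :=
  match hs return koszul M (map y hs) with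
  | [::] => 0
  | h :: t => (kone t u, kcst (map y t) (u h))
  end.

Lemma kcst_linear M ys : linear (@kcst M ys).
Proof.
elim: ys => [|x t IH] a u v //=.
by apply: injective_projections => /=; rewrite ?IH // scaler0 addr0.
Qed.
HB.instance Definition _ M ys :=
  GRing.isLinear.Build R M (koszul M ys) _ (@kcst M ys) (@kcst_linear M ys).

Lemma kcst_inj M ys : injective (@kcst M ys).
Proof. by elim: ys => [|x t IH] u v //= [/IH]. Qed.

Lemma kdeg_cst M ys (c : koszul M ys) : kdeg 1 c -> exists z, c = kcst ys z.
Proof.
elim: ys c => [|x t IH] c /=; first by exists c.
move=> [/IH[z c1] /kdeg0 c2]; exists z.
by apply: injective_projections.
Qed.

Lemma cst_kdeg M ys (z : M) : kdeg 1 (kcst ys z).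
Proof.
by elim: ys => [|x t IH] /=; [left | split=> //; apply: kdeg_zero].
Qed.

Lemma eq_kone M hs (u v : I -> M) :
  {in hs, u =1 v} -> kone hs u = kone hs v.
Proof.
elim: hs => [|h t IH] //= uv.
rewrite uv ?mem_head // IH // => x xt; apply: uv.
by rewrite inE xt orbT.
Qed.

Lemma kone_inj M hs (u v : I -> M) :
  kone hs u = kone hs v -> {in hs, u =1 v}.
Proof.
elim: hs => [|h t IH] //= [/IH tuv /kcst_inj huv] x.
by rewrite inE => /orP[/eqP -> //|/tuv].
Qed.

Lemma koneB M hs (u v : I -> M) :
  kone hs (fun h => u h - v h) = kone hs u - kone hs v.
Proof.
elim: hs => [|h t IH] /=; first by rewrite subrr.
by rewrite IH linearB.
Qed.

Lemma koneZ M hs a (u : I -> M) :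
  kone hs (fun h => a *: u h) = a *: kone hs u.
Proof.
elim: hs => [|h t IH] /=; first by rewrite scaler0.
by rewrite IH linearZ.
Qed.

Lemma kone0 M hs : kone hs (fun=> 0 : M) = 0.
Proof. by elim: hs => [|h t IH] //=; rewrite IH linear0. Qed.

(** Without repetition in the index list, a 1-cochain is a function of the
index. *)
Lemma kdeg_one M hs (c : koszul M (map y hs)) : uniq hs -> kdeg 2 c ->
  exists u, c = kone hs u.
Proof.
elim: hs c => [|h t IH] c /=; first by move=> _ [//|->]; exists (fun=> 0).
move=> /andP[ht tu] [/(IH _ tu) [u c1] /kdeg_cst[z c2]].
exists (fun x => if x == h then z else u x).
apply: injective_projections => /=; last by rewrite eqxx.
rewrite c1; apply: eq_kone => x xt.
by case: eqP => // xh; rewrite xh (negPf ht) in xt.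
Qed.

Lemma one_kdeg M hs (u : I -> M) : kdeg 2 (kone hs u).
Proof.
by elim: hs => [|h t IH] /=; [right | split=> //; apply: cst_kdeg].
Qed.

Lemma kd_cst M hs (z : M) :
  kd (kcst (map y hs) z) = kone hs (fun h => y h *: z).
Proof.
by elim: hs => [|h t IH] //=; rewrite IH linear0 subr0 -linearZ.
Qed.

Lemma kd_one M h t (u : I -> M) :
  kd (kone (h :: t) u) =
    (kd (kone t u), kone t (fun x => y h *: u x - y x *: u h)).
Proof. by rewrite /= kd_cst -koneZ koneB. Qed.

Lemma kmap_cst M N (f : {linear M -> N}) ys z :
  kmap f (kcst ys z) = kcst ys (f z).
Proof. by elim: ys => [|x t IH] //=; rewrite IH linear0. Qed.

Lemma kmap_one M N (f : {linear M -> N}) hs (u : I -> M) :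
  kmap f (kone hs u) = kone hs (f \o u).
Proof.
by elim: hs => [|h t IH] /=; rewrite ?linear0 // IH kmap_cst.
Qed.

Lemma kd_one_lift M N (f : {linear M -> N}) hs (u : I -> N) :
  {in hs &, forall h x, exists w, f w = y h *: u x - y x *: u h} ->
  exists2 w : koszul M (map y hs), kdeg 3 w & kmap f w = kd (kone hs u).
Proof.
elim: hs => [|h t IH] fu; first by exists 0; [right | rewrite /= linear0].
have [w1 w1d fw1] : exists2 w, kdeg 3 w & kmap f w = kd (kone t u).
  by apply: IH => a b ai bi; apply: fu; rewrite inE ?ai ?bi orbT.
have /choice[w2 fw2] x : exists w,
    x \in t -> f w = y h *: u x - y x *: u h.
  have [xt|xt] := boolP (x \in t); last by exists 0.
  by have [||w] := fu h x; rewrite ?inE ?eqxx ?xt ?orbT //; exists w.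
exists (w1, kone t w2); first by split=> //; apply: one_kdeg.
rewrite kd_one -fw1 /= kmap_one; congr (_, _).
exact: eq_kone.
Qed.

(** For f the inclusion of a submodule D of M: a 1-cochain u of M with
coboundary in D gives a 2-cocycle of D, which need not be a coboundary in D.  If
the second cohomology of D vanishes, a correction of u by elements of D makes it
closed. *)
Lemma koszul2_boundary D M (f : {linear D -> M}) hs (u : I -> M) :
  injective f -> uniq hs ->
  (forall c : koszul D (map y hs), kdeg 3 c -> kd c = 0 ->
     exists2 b, kdeg 2 b & kd b = c) ->
  {in hs &, forall h x, exists w, f w = y h *: u x - y x *: u h} ->
  exists v : I -> D,
    {in hs &, forall h x, y h *: (u x - f (v x)) = y x *: (u h - f (v h))}.
Proof.
move=> fI hsu acyc /kd_one_lift[w w3 fw].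
have [|b b2 db] := acyc w w3.
  by apply: (kmap_inj fI); rewrite kmap_kd fw kdK linear0.
have [v bv] := kdeg_one hsu b2; exists v.
have : kd (kone hs (fun h => u h - f (v h))) = 0.
  by rewrite koneB linearB /= -fw -db kmap_kd bv kmap_one subrr.
elim: (hs) => [|h t IH] //; rewrite kd_one => -[/IH {}IH e] a x.
have {}e : {in t, forall x, y h *: (u x - f (v x)) = y x *: (u h - f (v h))}.
  move: e; rewrite -(kone0 _ t) => /kone_inj e z zt.
  by apply/eqP; rewrite -subr_eq0 e.
rewrite !inE => /orP[/eqP->|a_t] /orP[/eqP->|xt] //; first exact: e.
  by rewrite e.
exact: IH.
Qed.
End LowDegree.

(** * Linear forms as regular elements *)

Section Ideals.
Local Open Scope ring_scope.
Variable R : comNzRingType.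
Implicit Types (ys : seq R) (g : R).

Lemma ideal_of0 ys : ideal_of ys 0.
Proof. by elim: ys => [|y t IH] //=; exists 0; rewrite mulr0 subr0. Qed.

Lemma ideal_ofD ys g h : ideal_of ys g -> ideal_of ys h -> ideal_of ys (g + h).
Proof.
elim: ys g h => [|y t IH] g h /=; first by move=> -> ->; rewrite addr0.
move=> [p gp] [q hq]; exists (p + q).
by rewrite mulrDr opprD addrACA; apply: IH.
Qed.

Lemma ideal_ofM ys a g : ideal_of ys g -> ideal_of ys (a * g).
Proof.
elim: ys g => [|y t IH] g /=; first by move=> ->; rewrite mulr0.
by move=> [p gp]; exists (a * p); rewrite mulrCA -mulrBr; apply: IH.
Qed.

Lemma ideal_of_sum (I : Type) (r : seq I) ys (F : I -> R) :
  (forall i, ideal_of ys (F i)) -> ideal_of ys (\sum_(i <- r) F i).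
Proof.
by move=> FI; apply: big_rec => [|i x _]; [apply: ideal_of0 | apply: ideal_ofD].
Qed.

Lemma morph_ideal_of (R' : nzRingType) (f : {rmorphism R -> R'}) ys g :
  {in ys, forall y, f y = 0} -> ideal_of ys g -> f g = 0.
Proof.
elim: ys g => [|y t IH] g f0 /=; first by move=> ->; rewrite rmorph0.
move=> [h /IH e]; rewrite -(subrK (y * h) g) rmorphD rmorphM.
rewrite (f0 y) ?mem_head //.
by rewrite mul0r addr0 e // => z zt; apply: f0; rewrite inE zt orbT.
Qed.
End Ideals.

Section LinearForms.
Local Open Scope ring_scope.
Variables (K : fieldType) (V : vectType K).
Local Notation n := (\dim {:V}).
Local Notation S := {mpoly K[n]}.
Local Notation dual := 'Hom(V, K^o).
Local Notation form := (@form_poly K V).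

Lemma form_linear : linear form.
Proof.
move=> c a b; rewrite /form_poly scaler_sumr -big_split /=.
by apply: eq_bigr => i _; rewrite !lfunE /= !lfunE scalerDl scalerA.
Qed.
HB.instance Definition _ := GRing.isLinear.Build K dual S _ form form_linear.

Lemma dualZ (a : dual) (c : K) (w : V) : a (c *: w) = c * (a w : K).
Proof. exact: linearZ. Qed.

Lemma coord_dual (a : dual) (v : V) :
  a v = \sum_(i < n) (coord (vbasis {:V}) i v : K) * (a (vbasis {:V})`_i : K).
Proof.
rewrite {1}(coord_vbasis (memvf v)) linear_sum.
by apply: eq_bigr => i _; rewrite linearZ.
Qed.

Lemma form_eq0 (a : dual) : form a = 0 -> a = 0.
Proof.
move=> a0; apply/lfunP => v; rewrite coord_dual lfunE big1 // => i _.
have /(congr1 (mcoeff U_(i))) := a0.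
rewrite /form_poly mcoeff0 raddf_sum (bigD1 i) //= big1 => [|j ji].
  by rewrite addr0 mcoeffZ mcoeffXU eqxx mulr1 => ->; rewrite mulr0.
by rewrite mcoeffZ mcoeffXU (negPf ji) mulr0.
Qed.

Variables (I : eqType) (alpha : I -> dual) (v : I -> V).

Definition dual_system (hs : seq I) :=
  {in hs &, forall h k, alpha h (v k) = (h == k)%:R}.

(** Substituting this tuple is restriction to the common zero space of the
alpha h, followed by pull-back along the projection w - sum_h alpha_h(w) v_h of
V onto that space.  When the v h are dual to the alpha h, the kernel of the
substitution is the ideal of the forms, which is thus seen to be prime. *)
Definition retract_tuple hs : n.-tuple S :=
  [tuple 'X_i - \sum_(h <- hs)
    (coord (vbasis {:V}) i (v h)) *: form (alpha h) | i < n].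
Local Notation retract hs := (comp_mpoly (retract_tuple hs)).

Lemma retract_form hs (a : dual) :
  retract hs (form a) = form (a - \sum_(h <- hs) a (v h) *: alpha h).
Proof.
transitivity (form a - \sum_(i < n) (a (vbasis {:V})`_i : K) *:
  \sum_(h <- hs) (coord (vbasis {:V}) i (v h)) *: form (alpha h)).
  rewrite {1 2}/form_poly raddf_sum -sumrB; apply: eq_bigr => i _.
  rewrite /= comp_mpolyZ comp_mpolyXU -(tnth_nth _ (retract_tuple hs)).
  by rewrite tnth_mktuple scalerBr.
rewrite [RHS]linearB; congr (_ - _); rewrite linear_sum /=.
under eq_bigr do rewrite scaler_sumr.
rewrite exchange_big; apply: eq_bigr => h _; rewrite linearZ /=.
rewrite coord_dual scaler_suml; apply: eq_bigr => i _.
by rewrite scalerA mulrC.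
Qed.

(** The polynomials congruent to their image modulo the forms are closed under
sums and products and contain the variables. *)
Lemma retract_mod hs (g : S) :
  ideal_of [seq form (alpha h) | h <- hs] (g - retract hs g).
Proof.
set ys := map _ _.
have retM p q : ideal_of ys (p - retract hs p) ->
    ideal_of ys (q - retract hs q) ->
    ideal_of ys (p * q - retract hs (p * q)).
  move=> ip iq; have -> : p * q - retract hs (p * q) =
      p * (q - retract hs q) + retract hs q * (p - retract hs p).
    by rewrite rmorphM !mulrBr addrA [retract hs q * p]mulrC subrK
      [retract hs q * _]mulrC.
  by apply: ideal_ofD; apply: ideal_ofM.
have ret1 : ideal_of ys (1 - retract hs 1).
  by rewrite rmorph1 subrr; apply: ideal_of0.
rewrite [g]mpolyE (raddf_sum (comp_mpoly (retract_tuple hs))) -sumrB.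
apply: ideal_of_sum => m /=.
rewrite linearZ -scalerBr -mul_mpolyC; apply: ideal_ofM.
rewrite mpolyXE_id; elim/big_rec: _ => // i q _ qI; apply: (retM _ _) => //.
elim: (m i) => [|k IH]; first by rewrite expr0.
rewrite exprS; apply: (retM _ _) => //.
rewrite comp_mpolyXU -(tnth_nth _ (retract_tuple hs)) tnth_mktuple.
rewrite opprB addrC subrK.
elim: (hs) @ys {retM ret1 IH qI} => [|h t IH] /=.
  by rewrite big_nil.
rewrite big_cons; exists ((coord (vbasis {:V}) i (v h))%:MP).
by rewrite mulrC mul_mpolyC addrAC subrr add0r.
Qed.

Lemma retract_gen hs : uniq hs -> dual_system hs ->
  {in [seq form (alpha h) | h <- hs], forall y, retract hs y = 0}.
Proof.
move=> hsu hsd _ /mapP[h hh ->]; rewrite retract_form.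
rewrite (bigD1_seq h) //= hsd // eqxx scale1r big1_seq => [|k /andP[kh kk]].
  by rewrite addr0 subrr linear0.
by rewrite hsd // eq_sym (negPf kh) scale0r.
Qed.

Lemma form_retract_neq0 hs (a : dual) (w : V) :
  {in hs, forall h, alpha h w = 0} -> a w != 0 -> retract hs (form a) != 0.
Proof.
move=> hw; apply: contra => /eqP; rewrite retract_form.
move=> /form_eq0 /lfunP /(_ w); rewrite lfunE /= !lfunE /= sum_lfunE.
rewrite big1_seq ?subr0 => [->//|h /andP[_ hh]].
by rewrite lfunE /= hw // scaler0.
Qed.

(** The witness w says that a does not vanish on the common zero space of the
alpha h; so its form is not in the kernel of the retraction, a ring morphism into
the domain S, and this kernel is the ideal of the alpha h. *)
Lemma form_regular hs (a : dual) (w : V) (g : S) :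
  uniq hs -> dual_system hs -> {in hs, forall h, alpha h w = 0} ->
  a w != 0 -> ideal_of [seq form (alpha h) | h <- hs] (form a * g) ->
  ideal_of [seq form (alpha h) | h <- hs] g.
Proof.
move=> hsu hsd hw aw /(morph_ideal_of (retract_gen hsu hsd)) /eqP.
rewrite rmorphM mulf_eq0 (negPf (form_retract_neq0 hw aw)) /= => /eqP g0.
by rewrite -[g]subr0 -g0; apply: retract_mod.
Qed.

Lemma dual_system_regular hs : uniq hs -> dual_system hs ->
  regular [seq form (alpha h) | h <- hs].
Proof.
elim: hs => [|h t IH] //= /andP[ht tu] hd.
have td : dual_system t.
  by move=> a b at_ bt; apply: hd; rewrite inE ?at_ ?bt orbT.
split=> [|g]; first exact: IH.
apply: (form_regular tu td (w := v h)).
  move=> k kt; rewrite hd ?mem_head ?inE ?kt ?orbT //.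
  by case: eqP kt ht => // -> ->.
by rewrite hd ?mem_head // eqxx oner_eq0.
Qed.
End LinearForms.

Section DivisionByForms.
Local Open Scope ring_scope.
Variables (K : fieldType) (V : vectType K).
Local Notation n := (\dim {:V}).
Local Notation S := {mpoly K[n]}.
Local Notation dual := 'Hom(V, K^o).
Local Notation form := (@form_poly K V).

Lemma form_dvd (a b : dual) (w : V) (g q : S) :
  a w = 0 -> b w != 0 -> a != 0 -> form b * g = q * form a ->
  exists p, g = p * form a.
Proof.
move=> aw bw a0 e.
have [v av] : exists v, a v = 1.
  have /eqP/lfunP ne := a0.
  have [v /eqP av] : exists v, a v <> 0.
    by apply/existsNP => a_0; apply: ne => v; rewrite a_0 lfunE.
  by exists ((a v : K)^-1 *: v); rewrite linearZ /=; apply: mulVf.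
have [] := @form_regular K V unit (fun=> a) (fun=> v) [:: tt] b w g.
- by [].
- by move=> [] [] _ _; rewrite av.
- by [].
- by [].
- by exists q; rewrite e mulrC subrr.
by move=> p /= /eqP; rewrite subr_eq0 => /eqP ->; exists p; rewrite mulrC.
Qed.

Lemma form_dvdX (a b : dual) (w : V) (g : S) k :
  a w = 0 -> b w != 0 -> a != 0 ->
  (exists q, form b * g = q * form a ^+ k) -> exists p, g = p * form a ^+ k.
Proof.
move=> aw bw a0; elim: k g => [|k IH] g [q e].
  by exists g; rewrite expr0 mulr1.
have [p gp] : exists p, g = p * form a.
  by apply: (form_dvd aw bw a0 (q := q * form a ^+ k)); rewrite e exprSr mulrA.
have [|p' pp] := IH p; last by exists p'; rewrite gp pp exprSr mulrA.
exists q; apply: (mulIf (x := form a)).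
  by apply: contra a0 => /eqP /form_eq0 ->.
by rewrite -mulrA -gp e exprSr mulrA.
Qed.
End DivisionByForms.

(** * Derivations and hyperplanes *)

Section Derivations.
Local Open Scope ring_scope.
Variables (K : fieldType) (V : vectType K).
Local Notation n := (\dim {:V}).
Local Notation S := {mpoly K[n]}.
Local Notation dual := 'Hom(V, K^o).
Local Notation form := (@form_poly K V).
Implicit Types (th : S -> S).

Lemma derivation0 : derivation (fun=> 0 : S).
Proof.
by split=> [c p q|p q]; rewrite ?scaler0 ?mul0r ?mulr0 addr0.
Qed.

Lemma derivationB th1 th2 : derivation th1 -> derivation th2 ->
  derivation (fun p => th1 p - th2 p).
Proof.
move=> [l1 d1] [l2 d2]; split=> [c p q|p q].
  by rewrite l1 l2 scalerBr opprD addrACA.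
by rewrite d1 d2 mulrBl mulrBr opprD addrACA.
Qed.

Lemma derivationM g th : derivation th -> derivation (fun p => g * th p).
Proof.
move=> [l d]; split=> [c p q|p q] /=.
  by rewrite l mulrDr scalerAr.
by rewrite d mulrDr !mulrA [p * g]mulrC.
Qed.

Lemma derivation_cancel g th : g != 0 -> derivation (fun p => g * th p) ->
  derivation th.
Proof.
move=> g0 [l d]; split=> [c p q|p q]; apply: (mulfI g0).
  by have /= -> := l c p q; rewrite mulrDr scalerAr.
by have /= -> := d p q; rewrite mulrDr !mulrA [p * g]mulrC.
Qed.

Definition directional (w : V) (p : S) : S :=
  \sum_(i < n) (coord (vbasis {:V}) i w : K) *: p^`M(i).

Lemma directional_derivation w : derivation (directional w).
Proof.
rewrite /directional; split=> [c p q|p q].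
  rewrite scaler_sumr -big_split; apply: eq_bigr => i _ /=.
  by rewrite linearP scalerDr !scalerA mulrC.
rewrite mulr_suml mulr_sumr -big_split; apply: eq_bigr => i _ /=.
by rewrite mderivM scalerDr scalerAl scalerAr.
Qed.

Lemma directional_form w (a : dual) : directional w (form a) = (a w : K)%:MP.
Proof.
rewrite coord_dual raddf_sum; apply: eq_bigr => i _.
rewrite /form_poly (raddf_sum (mderiv i)) (bigD1 i) //= big1 => [|j ji].
  rewrite mderivZ mderivX mnm1E eqxx.
  have -> : (U_(i) - U_(i) = 0 :> 'X_{1..n})%MM.
    by apply/mnmP => j; rewrite mnmBE mnm0E subnn.
  by rewrite mpolyX0 addr0 scale1r scalerA -[_ *: 1]mul_mpolyC mulr1.
by rewrite mderivZ mderivX mnm1E (negPf ji) scale0r scaler0.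
Qed.

End Derivations.

Section Hyperplanes.
Local Open Scope ring_scope.
Variables (K : fieldType) (V : vectType K).
Variables (A : {fset {vspace V}}) (alpha : {vspace V} -> 'Hom(V, K^o)).
Hypothesis arrA : arrangement A alpha.
Implicit Types (B : {fset {vspace V}}) (H X : {vspace V}) (w : V).

Lemma mem_hyperplane H w : H \in A -> (w \in H) = (alpha H w == 0).
Proof. by move=> /arrA[_ {1}<-]; rewrite memv_ker. Qed.

Lemma hyperplane_dim H : H \in A -> (\dim H).+1 = \dim {:V}.
Proof.
move=> /arrA[a0 eH]; rewrite -(limg_ker_dim (alpha H) fullv) capfv eH.
suff -> : \dim (limg (alpha H)) = 1%N by rewrite addn1.
apply/eqP; rewrite eqn_leq; apply/andP; split.
  by apply: leq_trans (dimvS (subvf _)) _; rewrite dimvf /dim /=.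
rewrite lt0n dimv_eq0; apply: contra a0 => /eqP l0.
apply/eqP/lfunP => v; rewrite lfunE /=; apply/eqP.
by rewrite -memv0 -l0 memv_img ?memvf.
Qed.

Lemma hyperplane_separation H H' : H \in A -> H' \in A -> H != H' ->
  exists2 w, alpha H w = 0 & alpha H' w != 0.
Proof.
move=> HA H'A; have [HH'|/subvPn[w wH wH']] := boolP (H <= H')%VS.
  rewrite -(dimv_leqif_eq HH') -eqSS !hyperplane_dim // eqxx //.
exists w; first by apply/eqP; rewrite -mem_hyperplane.
by rewrite -mem_hyperplane.
Qed.

Lemma mem_intersection B w :
  reflect (forall H, H \in B -> w \in H) (w \in intersection B).
Proof.
rewrite /intersection; apply: (iffP idP) => [wB H HB|wB].
  apply: subvP wB; have {}HB : H \in enum_fset B by [].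
  by rewrite (big_rem H HB) /= capvSl.
rewrite big_seq; elim/big_rec: _ => [|H X HB wX]; first exact: memvf.
by rewrite memv_cap wX wB.
Qed.

(** When dropping k enlarges the intersection, some vector lies on all other
hyperplanes of B and off k; scaled, it is the vector dual to alpha k. *)
Lemma independent_dual_vectors B : (B `<=` A)%fset ->
  (forall k, k \in B ->
    codim (intersection (B `\ k)%fset) <> codim (intersection B)) ->
  exists v, dual_system alpha v (enum_fset B).
Proof.
move=> BA Bind.
have /choice[v vP] k : exists w, k \in B ->
    {in B, forall H, alpha H w = (H == k)%:R}.
  have [kB|] := boolP (k \in B); last by exists 0.
  have kA := fsubsetP BA _ kB.
  have [w wB wk] : exists2 w, w \in intersection (B `\ k)%fset & w \notin k.
    apply/subvPn; apply: contra_notN (Bind k kB) => /subvP sub.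
    congr codim; apply/vspaceP => w; apply/mem_intersection/mem_intersection.
      move=> wB H HB; have [->|Hk] := eqVneq H k.
        exact/sub/mem_intersection.
      by apply: wB; rewrite !inE Hk.
    by move=> wB H; rewrite !inE => /andP[_]; apply: wB.
  rewrite mem_hyperplane // in wk.
  exists ((alpha k w : K)^-1 *: w) => _ H HB; rewrite linearZ /=.
  have [->|Hk] := eqVneq H k; first exact: mulVf.
  have HA := fsubsetP BA _ HB.
  have : w \in H by apply: (mem_intersection _ _ wB); rewrite !inE Hk.
  by rewrite mem_hyperplane // => /eqP ->; rewrite scaler0.
by exists v => H k HB kB; apply: vP.
Qed.
End Hyperplanes.

(** * The lower bound at a generic localization *)

Section GenericLocalization.
Local Open Scope fset_scope.
Local Open Scope ring_scope.
Variables (K : fieldType) (V : vectType K).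
Variables (A : {fset {vspace V}}) (alpha : {vspace V} -> 'Hom(V, K^o)).
Variable m : {vspace V} -> nat.
Hypothesis multA : multi_arrangement A alpha m.
Local Notation n := (\dim {:V}).
Local Notation S := {mpoly K[n]}.
Local Notation ell H := (form_poly (alpha H)).
Implicit Types (H k : {vspace V}) (q g : S).

Let arrA : arrangement A alpha := proj1 multA.

Lemma ell_neq0 H : H \in A -> ell H != 0.
Proof. by move=> /arrA[a0 _]; apply: contra a0 => /eqP/form_eq0 ->. Qed.

(** The residues of th modulo the powers of the forms are those of q times the
basis vector e_k of the sum of the modules S / ell H ^ m H. *)
Definition prescribed k q (th : S -> S) : Prop := derivation th /\
  forall H, H \in A ->
    exists p, th (ell H) = (H == k)%:R * q + p * ell H ^+ m H.

(** Vanishing of q e_k in the cokernel of the map from derivations to that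
sum. *)
Definition attained k q : Prop := exists th, prescribed k q th.

Lemma attainedM k g q : attained k q -> attained k (g * q).
Proof.
move=> [th [dth thq]]; exists (fun p => g * th p); split.
  exact: derivationM.
move=> H HA; have [p ->] := thq H HA; exists (g * p).
by rewrite mulrDr mulrCA -mulrA.
Qed.

Lemma attained_own k q : attained k (q * ell k ^+ m k).
Proof.
exists (fun=> 0); split=> [|H HA]; first exact: derivation0.
have [->|_] := eqVneq H k; last by exists 0; rewrite !mul0r addr0.
by exists (- q); rewrite mul1r mulNr subrr.
Qed.

(** Multiply by one form at a time, stopping just before its powers kill the
class, or at the exponent m H if that power does not kill it.  Multiplying further by other
forms preserves both alternatives. *)
Lemma socle_element k q (hs : seq {vspace V}) : ~ attained k q ->
  exists2 g, ~ attained k (g * q) &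
    {in hs, forall H,
      attained k (ell H * (g * q)) \/ exists p, g = p * ell H ^+ m H}.
Proof.
move=> nq; elim: hs => [|H t [g ng gt]]; first by exists 1; rewrite ?mul1r.
have step c : ~ attained k (c * (g * q)) ->
    attained k (ell H * (c * (g * q))) \/
      (exists p, c * g = p * ell H ^+ m H) ->
    exists2 g', ~ attained k (g' * q) & {in H :: t, forall H',
      attained k (ell H' * (g' * q)) \/ exists p, g' = p * ell H' ^+ m H'}.
  move=> nc cH; exists (c * g); rewrite -mulrA // => H'.
  rewrite inE => /orP[/eqP -> //|/gt[hH'|[p ->]]].
    by left; rewrite mulrCA; apply: attainedM.
  by right; exists (c * p); rewrite mulrA.
have [hm|nm] := pselect (attained k (ell H ^+ m H * (g * q))); last first.
  by apply: (step _ nm); right; exists g; rewrite mulrC.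
have hP : exists a, `[< attained k (ell H ^+ a * (g * q)) >].
  by exists (m H); apply/asboolP.
case: (ex_minnP hP) => -[|a] /asboolP ha amin.
  by case: ng; move: ha; rewrite expr0 mul1r.
apply: (step (ell H ^+ a)); last by left; rewrite mulrA -exprS.
by move=> /asboolP /amin; rewrite ltnn.
Qed.

(** The second hypothesis on u lets u_H p be divided by ell H, with a quotient
independent of H.  At each hyperplane H the residue of the quotient can be
computed after multiplication by the form of another member of Z, which is a
nonzerodivisor modulo ell H ^ m H. *)
Lemma attained_gluing k q (Z : {fset {vspace V}}) (v : {vspace V} -> V)
    (u : {vspace V} -> S -> S) :
  Z `<=` A -> (1 < #|` Z|)%N -> dual_system alpha v (enum_fset Z) ->
  {in Z, forall H, prescribed k (ell H * q) (u H)} ->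
  {in Z &, forall H H' p, ell H * u H' p = ell H' * u H p} -> attained k q.
Proof.
move=> ZA Z1 vZ uk ucyc.
have inA H : H \in Z -> H \in A by move/(fsubsetP ZA).
have other H : exists2 H', H' \in Z & H' != H.
  have : (0 < #|` Z `\ H|)%N.
    by move: Z1; rewrite (cardfsD1 H Z); case: (H \in Z) => //= /ltnW.
  by rewrite cardfs_gt0 => /fset0Pn[H']; rewrite !inE => /andP[]; exists H'.
have [H1 H1Z _] := other fullv%VS; have [H2 H2Z H21] := other H1.
have /choice[ze zeP] p : exists z, u H1 p = z * ell H1.
  apply: (form_dvd (a := alpha H1) (b := alpha H2) (w := v H2)
            (q := u H2 p)).
  - by rewrite vZ // eq_sym (negPf H21).
  - by rewrite vZ // eqxx oner_neq0.
  - by case: (arrA (inA _ H1Z)).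
  - by rewrite ucyc // mulrC.
have uze H p : H \in Z -> u H p = ell H * ze p.
  move=> HZ; apply: (mulfI (ell_neq0 (inA _ H1Z))).
  by rewrite ucyc // zeP [ze p * _]mulrC mulrCA.
exists ze; split.
  apply: (derivation_cancel (ell_neq0 (inA _ H1Z))).
  have [du _] := uk _ H1Z; suff <- : u H1 = (fun p => ell H1 * ze p) by [].
  by apply/funext => p; apply: uze.
move=> H HA; have [H' H'Z H'H] := other H.
have [w Hw H'w] : exists2 w, alpha H w = 0 & alpha H' w != 0.
  by apply: (hyperplane_separation arrA) => //; [apply: inA | rewrite eq_sym].
have [_ /(_ H HA)[p e]] := uk _ H'Z.
have [|p' ep] := form_dvdX (g := ze (ell H) - (H == k)%:R * q) (k := m H) Hw H'w
  (proj1 (arrA HA)).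
  by exists p; rewrite mulrBr -uze // e mulrCA addrAC subrr add0r.
by exists p'; rewrite -ep addrC subrK.
Qed.

Variable X : {vspace V}.
Hypothesis latX : in_lattice A X.
Local Notation L := (localization A X).
Hypothesis genL : generic L.
Hypothesis bigL : (codim X < #|` L|)%N.

Lemma mem_localization H : (H \in L) = (H \in A) && (X <= H)%VS.
Proof. by rewrite /localization !inE. Qed.

Lemma sub_localization : L `<=` A.
Proof. by apply/fsubsetP => H; rewrite mem_localization => /andP[]. Qed.

Lemma intersection_localization : intersection L = X.
Proof.
apply/vspaceP => w; apply/mem_intersection/idP => [wL|wX H].
  have [B BA eX] := latX; rewrite eX; apply/mem_intersection => H HB.
  apply: wL; rewrite mem_localization (fsubsetP BA) //= eX.
  by apply/subvP => z /mem_intersection; apply.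
by rewrite mem_localization => /andP[_ /subvP]; apply.
Qed.

(** In a generic arrangement, r or fewer hyperplanes are independent. *)
Lemma generic_dual_vectors B : B `<=` L -> (#|` B| <= codim X)%N ->
  exists v, dual_system alpha v (enum_fset B).
Proof.
move=> BL Br; apply: (independent_dual_vectors arrA).
  exact: fsubset_trans BL sub_localization.
move=> k kB; have cB C : C `<=` B -> codim (intersection C) = #|` C|.
  move=> CB; apply: genL; first exact: fsubset_trans CB BL.
  rewrite intersection_localization.
  exact: leq_trans (fsubset_leq_card CB) Br.
rewrite !cB ?fsubsetDl //; rewrite [in RHS](cardfsD1 k) kB add1n => /eqP.
by rewrite -[X in X == _]addn0 -addn1 eqn_add2l.
Qed.

Lemma fsub_card (B : {fset {vspace V}}) r : (r <= #|` B|)%N ->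
  exists2 C, C `<=` B & #|` C| = r.
Proof.
move=> rB; exists [fset x in take r (enum_fset B)].
  by apply/fsubsetP => x; rewrite inE => /mem_take.
rewrite card_fseq undup_id ?size_takel //.
exact: take_uniq.
Qed.

(** Invertible at the generic point of X, and zero modulo ell H ^ m H for each H
that does not contain X: multiplying by it amounts to localizing at X. *)
Definition outer : S := \prod_(H <- enum_fset A | H \notin L) ell H ^+ m H.

(** Among the hyperplanes through X other than k there are r independent ones;
their forms generate the ideal of X and span ell k.  Reducing modulo that ideal,
a derivation with these residues would send ell k both to zero and to the
nonzero class of outer. *)
Lemma not_attained_outer k : k \in L -> ~ attained k outer.
Proof.
move=> kL [th [dth thP]].
have [B BLk Br] : exists2 B, B `<=` L `\ k & #|` B| = codim X.
  by apply: fsub_card; move: bigL; rewrite (cardfsD1 k) kL add1n ltnS.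
have BL : B `<=` L := fsubset_trans BLk (fsubsetDl _ _).
have [|v vB] := generic_dual_vectors BL; first by rewrite Br.
have XB : X = intersection B.
  apply/eqP; rewrite eqEdim; apply/andP; split.
    apply/subvP => w wX; apply/mem_intersection => H /(fsubsetP BL).
    by rewrite mem_localization => /andP[_ /subvP]; apply.
  have : codim (intersection B) = codim X.
    by rewrite (genL BL) // intersection_localization Br.
  rewrite /codim => /(congr1 (subn (\dim {:V}))).
  by rewrite !subKn ?(dimvS (subvf _)) // => ->.
have inA H : H \in B -> H \in A.
  by move=> /(fsubsetP BL)/(fsubsetP sub_localization).
have kA : k \in A by apply: (fsubsetP sub_localization).
have alk : alpha k = \sum_(H <- B) alpha k (v H) *: alpha H.
  apply/lfunP => w; apply/eqP; rewrite -subr_eq0 sum_lfunE; apply/eqP.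
  (* The component of w along X; alpha k vanishes on it. *)
  pose w' := w - \sum_(H <- B) (alpha H w : K) *: v H.
  have w'X : w' \in X.
    rewrite XB; apply/mem_intersection => H HB.
    rewrite (mem_hyperplane arrA) ?inA // linearB linear_sum /=.
    rewrite (bigD1_seq H) ?fset_uniq //= dualZ vB // eqxx mulr1 big1_seq.
      by rewrite addr0 subrr.
    move=> H' /andP[H'H H'B].
    by rewrite dualZ vB // eq_sym (negPf H'H) mulr0.
  have := kL; rewrite mem_localization => /andP[_ /subvP /(_ _ w'X)].
  rewrite (mem_hyperplane arrA) // linearB linear_sum /= => /eqP e.
  rewrite -[RHS]e.
  congr (_ - _). apply: eq_bigr => H _.
  by rewrite lfunE dualZ; apply: mulrC.
pose rho := comp_mpoly (retract_tuple alpha v (enum_fset B)).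
have rhoB H : H \in B -> rho (ell H) = 0.
  by move=> HB; apply: (retract_gen (fset_uniq B) vB); apply/mapP; exists H.
have mpos H : H \in A -> (0 < m H)%N by apply: (proj2 multA).
have formk : ell k = \sum_(H <- B) (alpha k (v H) : K) *: ell H.
  by rewrite {1}alk linear_sum; apply: eq_bigr => H _; rewrite linearZ.
have rhok : rho (ell k) = 0.
  rewrite formk /rho raddf_sum big1_seq // => H /andP[_ HB] /=.
  by rewrite comp_mpolyZ -/rho rhoB // scaler0.
have rhopow H p : H \in A -> rho (ell H) = 0 -> rho (p * ell H ^+ m H) = 0.
  move=> HA r0; rewrite /rho rmorphM rmorphXn /= -/rho r0.
  by rewrite expr0n eqn0Ngt mpos ?mulr0.
have th_sum : th (ell k) = \sum_(H <- B) (alpha k (v H) : K) *: th (ell H).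
  have [lin _] := dth.
  have th0 : th 0 = 0.
    by have := lin (-1) 0 0; rewrite scaleN1r oppr0 addr0 scaleN1r addNr.
  rewrite formk; elim/big_rec2: _ => // H y1 y2 _ e.
  by rewrite lin e.
have [p ep] := thP k kA; have : rho (th (ell k)) = 0.
  rewrite th_sum /rho raddf_sum big1_seq // => H /andP[_ HB] /=.
  have [p' ->] := thP H (inA _ HB).
  have /negPf -> : H != k.
    by move: (fsubsetP BLk _ HB); rewrite !inE => /andP[].
  by rewrite mul0r add0r comp_mpolyZ -/rho rhopow ?scaler0 ?inA ?rhoB.
rewrite ep eqxx mul1r /rho rmorphD /= -/rho rhopow // addr0 => /eqP; apply/negP.
rewrite /outer /rho rmorph_prod /= prodf_seq_neq0; apply/allP => H HA.
apply/implyP => HL; rewrite rmorphXn /= expf_neq0 //.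
have /subvPn[w wX wH] : ~~ (X <= H)%VS.
  by move: HL; rewrite mem_localization HA.
(* The point w of X off H shows that ell H is nonzero on X. *)
apply: (@form_retract_neq0 _ _ _ _ _ _ _ w).
  move=> H' H'B; apply/eqP; rewrite -(mem_hyperplane arrA) ?inA //.
  by move: wX; rewrite XB => /mem_intersection; apply.
by rewrite -(mem_hyperplane arrA).
Qed.

(** Otherwise the forms killing the class are independent and include ell k.
The constant vector field dual to ell k among them, multiplied by g * outer, has
residue g * outer at k and 0 at the other killing forms.  At every remaining
hyperplane H the coefficient itself is divisible by ell H ^ m H. *)
Lemma socle_hyperplanes k g : k \in L -> ~ attained k (g * outer) ->
  {in L, forall H,
    attained k (ell H * (g * outer)) \/ exists p, g = p * ell H ^+ m H} ->
  (codim X <= #|` [fset H in L | `[< attained k (ell H * (g * outer)) >]]|)%N.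
Proof.
set Z := [fset H in L | _] => kL ng gL; rewrite leqNgt; apply/negP => Zr.
have ZP H : reflect (H \in L /\ attained k (ell H * (g * outer))) (H \in Z).
  rewrite !inE /=; apply: (iffP andP) => -[HL hH]; split=> //; exact/asboolP.
have ZL : Z `<=` L by apply/fsubsetP => H /ZP[].
have kZ : k \in Z.
  have [hk|[p gp]] := gL k kL; first exact/ZP.
  by case: ng; rewrite gp mulrAC; apply: attained_own.
have [v vZ] := generic_dual_vectors ZL (ltnW Zr).
apply: ng; exists (fun p => (g * outer) * directional (v k) p); split.
  exact/derivationM/directional_derivation.
move=> H HA; rewrite directional_form.
have [HZ|HZ] := boolP (H \in Z).
  exists 0; rewrite vZ // mul0r addr0; case: (H == k); rewrite ?mul1r ?mulr1 //.
  by rewrite mul0r mulr0.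
have -> : (H == k) = false by apply: contraNF HZ => /eqP ->.
suff [p ->] : exists p, g * outer = p * ell H ^+ m H.
  by exists (p * (alpha H (v k) : K)%:MP); rewrite mul0r add0r mulrAC.
have [HL|HL] := boolP (H \in L).
  have [hH|[p ->]] := gL H HL; first by case/negP: HZ; apply/ZP.
  by exists (p * outer); rewrite mulrAC.
rewrite /outer (big_rem H) //= HL mulrCA mulrC.
by eexists.
Qed.

Local Notation D := (log_module A alpha m).

(** A resolution of length d < r - 2 would kill the degree-2 Koszul cohomology
of D for r independent forms that kill a nonzero class of the cokernel. *)
Theorem localization_pdim : pdim_ge D (codim X - 2).
Proof.
rewrite /pdim_ge /pdim; case: pselect => // exn.
case: (ex_minnP (pdim_subproof exn)) => d /asboolP resd _; rewrite leqNgt.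
apply/negP => dr.
have dr3 : (3 + d <= codim X)%N by move: dr; rewrite ltn_subRL.
have [k kL] : exists k, k \in L.
  by apply/fset0Pn; rewrite -cardfs_gt0; apply: leq_ltn_trans bigL.
(* A nonzero class g f e_k of the cokernel with r independent annihilators Z. *)
have [g ng gL] := socle_element (enum_fset L) (not_attained_outer kL).
have [Z ZZ' Zr] := fsub_card (socle_hyperplanes kL ng gL).
have {ZZ'} [ZL attZ] :
    Z `<=` L /\ {in Z, forall H, attained k (ell H * (g * outer))}.
  split; first by apply/fsubsetP => H /(fsubsetP ZZ'); rewrite !inE => /andP[].
  by move=> H /(fsubsetP ZZ'); rewrite !inE => /andP[_ /asboolP].
have [|v vZ] := generic_dual_vectors ZL; first by rewrite Zr.
have ZA := fsubset_trans ZL sub_localization.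
(* Lifts of the multiples of that class by the forms of Z. *)
have /choice[th thP] H :
    exists th, H \in Z -> prescribed k (ell H * (g * outer)) th.
  have [/attZ[th thH]|] := boolP (H \in Z); first by exists th.
  by exists (fun=> 0).
have [||||eta etaP] := @koszul2_boundary _ _ (fun H => ell H) D (S -> S^o)%type
  (\val : {linear D -> (S -> S^o)}) (enum_fset Z) th.
- exact: val_inj.
- exact: fset_uniq.
- move=> c c3 dc; apply: (koszul_resolution resd _ _ c3 dc).
    exact: dual_system_regular (fset_uniq Z) vZ.
  by rewrite size_map -/(#|` Z|) Zr.
- move=> H H' HZ H'Z.
  have [dth thp] := thP H HZ; have [dth' thp'] := thP H' H'Z.
  pose w : S -> S^o := fun p => ell H * th H' p - ell H' * th H p.
  have wP : w \in log_pred A alpha m.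
    apply/asboolP; split.
      by apply: derivationB; apply: derivationM.
    move=> H1 H1A; have [p ep] := thp H1 H1A; have [p' ep'] := thp' H1 H1A.
    exists (ell H * p' - ell H' * p); rewrite /w ep ep'.
    by ring.
  by exists (LogDer wP).
apply: ng.
apply: (attained_gluing ZA _ vZ (u := fun H p => th H p - log_fun (eta H) p)).
- by rewrite Zr; apply: leq_trans dr3.
- move=> H HZ; have [dth thp] := thP H HZ.
  have /asboolP[deta etap] := valP (eta H).
  split; first exact: derivationB.
  move=> H1 H1A; have [p ep] := thp H1 H1A; have [p' ep'] := etap H1 H1A.
  by exists (p - p'); rewrite ep ep' mulrBl addrA.
- by move=> H H' HZ H'Z p; have /(congr1 (fun f => f p)) := etaP H H' HZ H'Z.
Qed.
End GenericLocalization.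

(** * Closed circuits *)

Section MatroidRank.
Local Open Scope ring_scope.
Variables (K : fieldType) (V : vectType K).
Local Notation dual := 'Hom(V, K^o).

(** Induction on s: if b does not vanish on the common zeros of t, a multiple of
b corrects a to a functional that does, by comparing with a fixed common zero of
t where b is nonzero. *)
Lemma span_annihilator (s : seq dual) (a : dual) :
  (forall w : V, {in s, forall b : dual, b w = 0} -> a w = 0) -> a \in <<s>>%VS.
Proof.
elim: s a => [|b t IH] a aw.
  suff -> : a = 0 by apply: mem0v.
  by apply/lfunP => w; rewrite lfunE; apply: aw.
rewrite span_cons.
have [bt|/existsNP[w0 /not_implyP[tw0 /eqP bw0]]] :=
    pselect (forall w : V, {in t, forall c : dual, c w = 0} -> b w = 0).
  apply: subvP (addvSr _ _) _ (IH a _) => w tw; apply: aw => c.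
  by rewrite inE => /predU1P[->|/tw //]; apply: bt.
(* With this c, a - c b vanishes at w0 and on the common zeros of b and t. *)
pose c : K := (a w0 : K) / (b w0 : K).
rewrite -(subrK (c *: b) a) addrC memv_add ?memvZ ?memv_line //.
apply: IH => w tw.
have := aw (w - ((b w : K) / (b w0 : K)) *: w0).
rewrite linearB /= dualZ => aw'.
rewrite add_lfunE opp_lfunE scale_lfunE -[RHS]aw'.
  congr (_ - _); rewrite /c -[LHS]/(_ * _) mulrAC [RHS]mulrAC.
  by rewrite [(a w0 : K) * _]mulrC.
move=> e; rewrite inE linearB /= dualZ => /predU1P[->|et].
  by rewrite divfK // subrr.
by rewrite (tw e et) (tw0 e et) mulr0 subrr.
Qed.

Variables (A : {fset {vspace V}}) (alpha : {vspace V} -> 'Hom(V, K^o)).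
Hypothesis arrA : arrangement A alpha.
Implicit Types (B : {fset {vspace V}}) (H X : {vspace V}) (w : V).

(** Adding H either changes neither side or raises both by one, according to
whether alpha H is in the span of the previous forms; by duality this means that
H contains the previous intersection. *)
Lemma codim_intersection_rank B : (B `<=` A)%fset ->
  codim (intersection B) = matroid_rank alpha B.
Proof.
move=> /fsubsetP; rewrite /codim /intersection /matroid_rank.
have mem_cap (s : seq {vspace V}) w :
    w \in (\bigcap_(H <- s) H)%VS -> {in s, forall H, w \in H}.
  elim: s => [|H t IH] //; rewrite big_cons memv_cap => /andP[wH wt] H'.
  by rewrite inE => /predU1P[->|/(IH wt)].
have cap_mem (s : seq {vspace V}) w :
    {in s, forall H, w \in H} -> w \in (\bigcap_(H <- s) H)%VS.
  elim: s => [|H t IH] ws; first by rewrite big_nil memvf.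
  rewrite big_cons memv_cap ws ?mem_head //= IH // => H' H't.
  by rewrite ws // inE H't orbT.
suff rank_nullity s : {subset s <= A} ->
    (\dim (\bigcap_(H <- s) H)%VS + \dim <<[seq alpha H | H <- s]>> =
      \dim {:V})%N.
  by move=> /rank_nullity <-; rewrite addKn.
elim: s => [|H t IH] sA; first by rewrite big_nil span_nil dimv0 addn0.
have HA : H \in A by apply: sA; apply: mem_head.
have tA : {subset t <= A} by move=> z zt; apply: sA; rewrite inE zt orbT.
rewrite big_cons /= span_cons -(IH tA); set W := (\bigcap_(H <- t) H)%VS.
set T := <<_>>%VS.
have Wt w : w \in W -> {in map alpha t, forall b : dual, b w = 0}.
  move=> wW _ /mapP[H' H't ->]; apply/eqP.
  by rewrite -(mem_hyperplane arrA) ?tA //; apply: mem_cap wW _ H't.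
have [aT|aT] := boolP (alpha H \in T).
  have WH : (W <= H)%VS.
    apply/subvP => w /Wt wW; rewrite (mem_hyperplane arrA) //.
    rewrite (@coord_span _ _ _ (in_tuple [seq alpha H | H <- t]) _ aT).
    rewrite sum_lfunE big1 // => i _.
    by rewrite lfunE /= wW ?scaler0 // mem_nth.
  rewrite (capv_idPr WH); congr (_ + \dim _)%N.
  by apply/addv_idPr; rewrite -memvE.
have -> : \dim (<[alpha H]> + T) = (\dim T).+1.
  rewrite dimv_disjoint_sum ?dim_vline.
    by case: (arrA HA) => ->.
  apply/eqP; rewrite -subv0; apply/subvP => b; rewrite memv_cap memv0.
  move=> /andP[/vlineP[c ->] cT].
  have [->|c0] := eqVneq c 0; first by rewrite scale0r.
  by case/negP: aT; rewrite -(scale1r (alpha H)) -(mulVf c0) -scalerA memvZ.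
have [w wW wH] : exists2 w, w \in W & w \notin H.
  apply/subvPn; apply: contra aT => /subvP WH; apply: span_annihilator => w tw.
  apply/eqP; rewrite -(mem_hyperplane arrA) //; apply/WH/cap_mem => H' H't.
  by rewrite (mem_hyperplane arrA) ?tA // tw // map_f.
have HW : (H + W = fullv)%VS.
  apply/eqP; rewrite eqEdim subvf -(hyperplane_dim arrA HA) ltn_neqAle.
  rewrite dimvS ?addvSl // andbT (dimv_leqif_eq (addvSl _ _)).
  apply: contra wH => /eqP ->; exact: subvP (addvSr _ _) _ wW.
have := dimv_sum_cap H W.
rewrite HW -(hyperplane_dim arrA HA) addSnnS => /addnI <-.
by rewrite addSnnS.
Qed.

(** A hyperplane through X has its form in the span of the forms of C, so it
belongs to the flat C.  Proper subsets of the circuit are independent, which is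
genericity, and force the rank of C to be its size minus one. *)
Lemma closed_circuit_localization C : closed_circuit A alpha C ->
  let X := intersection C in
  [/\ in_lattice A X, localization A X = C, generic (localization A X)
    & (codim X).+1 = #|` C|].
Proof.
move=> [[CA Cdep Cmin] [_ Cflat]] X.
have rankC : (codim X).+1 = #|` C|.
  rewrite codim_intersection_rank //.
  have rC : (matroid_rank alpha C <= #|` C|)%N.
    by rewrite /matroid_rank; apply: leq_trans (dim_span _) _; rewrite size_map.
  have [C0|[H HC]] := fset_0Vmem C.
    case: Cdep; rewrite /matroid_indep; apply/eqP; rewrite eqn_leq rC.
    by rewrite C0 cardfs0.
  apply/eqP; rewrite eqn_leq ltn_neqAle rC andbT; apply/andP; split.
    by apply/eqP.
  rewrite (cardfsD1 H) HC add1n ltnS -(Cmin _ (fproperD1 HC)).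
  apply/dimvS/sub_span => b /mapP[H' H'C ->]; apply: map_f.
  by move: H'C; rewrite !inE => /andP[].
have locC : localization A X = C.
  apply/fsetP => H; rewrite mem_localization.
  apply/andP/idP => [[HA XH]|HC]; last first.
    split; first exact: (fsubsetP CA).
    by apply/subvP => w /mem_intersection; apply.
  apply: contraT => HC; have := Cflat H HA HC; rewrite ltnNge => /negP[].
  apply/dimvS/span_subvP => b /mapP[H' H'HC ->].
  have : H' \in (H |` C)%fset by [].
  rewrite !inE => /predU1P[->|H'C]; last by apply: memv_span; apply: map_f.
  apply: span_annihilator => w Cw; apply/eqP.
  rewrite -(mem_hyperplane arrA) //; apply: (subvP XH).
  apply/mem_intersection => H1 H1C.
  rewrite (mem_hyperplane arrA) ?(fsubsetP CA) //; apply/eqP/Cw.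
  exact: map_f.
split; rewrite ?locC //; first by exists C.
move=> B BC; rewrite -/X => Br.
rewrite codim_intersection_rank; last exact: fsubset_trans BC CA.
by apply: Cmin; rewrite fproperEcard BC -rankC ltnS.
Qed.
End MatroidRank.

Theorem corollary3p15 (K : fieldType) (V : vectType K)
    (A : {fset {vspace V}}) (alpha : {vspace V} -> 'Hom(V, K^o))
    (m : {vspace V} -> nat) (hA : multi_arrangement A alpha m) :
  (forall X : {vspace V}, in_lattice A X ->
     generic (localization A X) ->
     codim X < #|` localization A X| ->
     pdim_ge (log_module A alpha m) (codim X - 2)) /\
  (forall (C : {fset {vspace V}}) (l : nat), closed_circuit A alpha C ->
     #|` C| = l ->
     pdim_ge (log_module A alpha m) (l - 3)).
Proof.
split=> [X|C l Ccirc <-]; first exact: localization_pdim.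
have [latX locX genX rX] := closed_circuit_localization (proj1 hA) Ccirc.
rewrite -rX subSS; apply: localization_pdim => //.
by rewrite locX -rX.
Qed.
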